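(* For each $t=2,\dots,T$ let the distance tolerance satisfy $d_t(N_t)\to0$ as the size $N_t$ of historical data samples increases to $\infty$. Then, as $N_t\to\infty$ for all $t\ge2$, one has $\max_{\xi_t\in\Omega_t}|f^t(\xi_t)-f_0^t(\xi_t)|\to0$ for any choice of $f^t\in\mathcal D^t$, and $$\hat z(d_2(N_2),\dots,d_T(N_T))\to z(0).$$ Furthermore, $\hat U(d_2(N_2),\dots,d_T(N_T))$ converges to $U(0)$, i.e. $$\lim_{N_2,\dots,N_T\to\infty}\ \sup_{x\in\hat U(d_2(N_2),\dots,d_T(N_T))}\|x-U(0)\|=0,$$ where $\|x-U(0)\|$ denotes the distance from $x$ to the set $U(0)$. Here $z(0)$ and $U(0)$ are the optimal value and the set of optimal solutions of the risk-neutral multistage stochastic program under the true distributions, and $\hat z(d_2(N_2),\dots,d_T(N_T))$ and $\hat U(d_2(N_2),\dots,d_T(N_T))$ are the optimal value and the set of optimal solutions of the risk-averse multistage stochastic program with tolerances $d_t(N_t)$.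
   Context: The horizon is $T\ge2$; first-stage data $c_1,b_1,A_1$ are deterministic. For $t=2,\dots,T$ the random parameter $\xi_t$ takes values in a finite set $\Omega_t=\{\xi_t^1,\dots,\xi_t^R\}$, with data $c_t(\xi_t),b_t(\xi_t),A_t(\xi_t),B_t(\xi_t)$, and the data process is stagewise independent. The true distribution of $\xi_t$ on $\Omega_t$ is fixed but unknown. For each $t$, a reference distribution $f_0^t$ on $\Omega_t$ is constructed from the empirical distribution of $N_t$ historical data samples, and $f_0^t$ converges weakly to the true distribution of $\xi_t$ as $N_t\to\infty$. The ambiguity set at stage $t$ is $$\mathcal D^t=\Big\{f\ge0:\ \|f-f_0^t\|_\infty\le d_t(N_t),\ \sum_{r=1}^Rf^r=1\Big\},$$ where $d_t(N_t)\geq 0$ is a tolerance that decreases as $N_t$ increases. The risk-averse multistage stochastic program (RMSP) is $$\min_{A_1x_1\ge b_1}c_1x_1+\sup_{\mathbb P_2\in\mathcal D^2}\mathbb E_{\mathbb P_2}\Big[\min_{A_2x_2\ge b_2-B_2x_1}c_2x_2+\cdots+\sup_{\mathbb P_T\in\mathcal D^T}\mathbb E_{\mathbb P_T}\big[\min_{A_Tx_T\ge b_T-B_Tx_{T-1}}c_Tx_T\big]\Big];$$ the risk-neutral multistage stochastic program (MSP) under the true distributions is the same program with each $\sup_{\mathbb P_t\in\mathcal D^t}\mathbb E_{\mathbb P_t}$ replaced by the expectation under the true distribution of $\xi_t$. A solution $x$ is the (finite-dimensional) collection of the decisions at all stages and all scenarios of the scenario tree (a stage-$t$ decision for each possible observation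 history up to stage $t$); it is feasible if the constraints hold along every scenario. The RMSP objective value of a feasible $x$ is the nested value $c_1x_1+\sup_{\mathbb P_2\in\mathcal D^2}\mathbb E_{\mathbb P_2}[c_2x_2+\cdots+\sup_{\mathbb P_T\in\mathcal D^T}\mathbb E_{\mathbb P_T}[c_Tx_T]]$, and its MSP objective value is the expected total cost under the true distributions. Optimal solutions are feasible $x$ minimizing the corresponding objective value. Standing assumption: the program has compact feasible set and relatively complete recourse, and the recourse function at each stage is bounded for each decision $x$. *)

(* Defs.v *)
From mathcomp Require Import all_boot all_order all_algebra.
From mathcomp Require Import all_classical all_reals all_analysis.
Import Order.TTheory GRing.Theory Num.Theory.
Import numFieldNormedType.Exports.

Set Implicit Arguments.
Unset Strict Implicit.
Unset Printing Implicit Defensive.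

Local Open Scope classical_set_scope.
Local Open Scope ring_scope.

(* Stages are numbered from 0 to horizon - 1 (the usual stage 1, whose data are
   deterministic, is stage 0).  For 0 < t < horizon the parameter xi_t takes
   [nout] values, indexed by 'I_nout; a stage-t decision thus depends on a
   history in t.-tuple 'I_nout, namely (xi_1, ..., xi_t).  The fields
   c, b, A, B are only used at the random stages 0 < t < horizon. *)
Record program (R : realType) := Program {
  horizon : nat;
  nout : nat;
  nvar : nat -> nat;
  ncon : nat -> nat;
  c0 : 'rV[R]_(nvar 0);
  b0 : 'cV[R]_(ncon 0);
  A0 : 'M[R]_(ncon 0, nvar 0);
  c : forall t, 'I_nout -> 'rV[R]_(nvar t);
  b : forall t, 'I_nout -> 'cV[R]_(ncon t);
  A : forall t, 'I_nout -> 'M[R]_(ncon t, nvar t);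
  B : forall t, 'I_nout -> 'M[R]_(ncon t, nvar t.-1) }.

Arguments c {R} p t _.
Arguments b {R} p t _.
Arguments A {R} p t _.
Arguments B {R} p t _.

Section Distributions.
Variables (R : realType) (K : nat).

Definition is_pmf (f : 'rV[R]_K) :=
  (forall r, 0 <= f 0 r) /\ \sum_r f 0 r = 1.

(* `| _ | on row vectors is the sup norm. *)
Definition ambiguity (f0 : 'rV[R]_K) (d : R) : set 'rV[R]_K :=
  [set f | is_pmf f /\ `|f - f0| <= d].

(* The ambiguity sets of all random stages, when xi_t has N t samples. *)
Definition ambiguities (f0 : nat -> nat -> 'rV[R]_K) (d : nat -> nat -> R)
    (N : nat -> nat) : nat -> set 'rV[R]_K :=
  fun t => ambiguity (f0 t (N t)) (d t (N t)).

Definition weakly_cvg (f : nat -> 'rV[R]_K) (p : 'rV[R]_K) :=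
  forall g : 'I_K -> R,
    \sum_r f N 0 r * g r @[N --> \oo] --> \sum_r p 0 r * g r.

Local Open Scope ereal_scope.

Definition expect (f : 'rV[R]_K) (Z : 'I_K -> \bar R) : \bar R :=
  \sum_r (f 0%R r)%:E * Z r.

Definition sup_expect (D : set 'rV[R]_K) (Z : 'I_K -> \bar R) : \bar R :=
  ereal_sup [set expect f Z | f in D].

End Distributions.

Section Program.
Variables (R : realType) (P : program R).
Notation T := (horizon P).
Notation K := (nout P).
Notation n := (nvar P).

Definition lev m (u v : 'cV[R]_m) := forall i, u i 0 <= v i 0.

Definition dot m (u : 'rV[R]_m) (v : 'cV[R]_m) : R := (u *m v) 0 0.

Definition feasible0 : set 'cV[R]_(n 0) :=
  [set x | lev (b0 P) (A0 P *m x)].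

(* Feasible stage-t.+1 decisions after the stage-t decision y, for the
   outcome r of xi_(t.+1). *)
Definition feasible_next t (r : 'I_K) (y : 'cV[R]_(n t)) :
    set 'cV[R]_(n t.+1) :=
  [set x | lev (b P t.+1 r - B P t.+1 r *m y) (A P t.+1 r *m x)].

(* The stage-t decisions that end a feasible sequence of decisions along some
   history of length t. *)
Fixpoint reachable t : set 'cV[R]_(n t) :=
  match t with
  | 0 => feasible0
  | s.+1 => [set x | exists y r, reachable y /\ @feasible_next s r y x]
  end.

Definition relatively_complete_recourse :=
  forall t (y : 'cV[R]_(n t)), (t.+1 < T)%N -> reachable y ->
    forall r, feasible_next r y !=set0.

(* A risk measure is assigned to each random stage: the expectation under the
   distribution of xi_t, or its supremum over the ambiguity set. *)
Definition risk := nat -> ('I_K -> \bar R) -> \bar R.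

(* Recourse function of stage t.+1, which is followed by k further stages. *)
Fixpoint recourse (rho : risk) k t (r : 'I_K) (y : 'cV[R]_(n t)) : \bar R :=
  ereal_inf [set ((dot (c P t.+1 r) x)%:E +
      (if k is k'.+1 then rho t.+2 (fun s => recourse rho k' s x) else 0))%E
    | x in feasible_next r y].

Definition recourse_bounded (rho : risk) :=
  forall t (y : 'cV[R]_(n t)), (t.+1 < T)%N -> reachable y ->
    forall r, recourse rho (T - t.+2) r y \is a fin_num.

Definition optimal_value (rho : risk) : \bar R :=
  ereal_inf [set ((dot (c0 P) x)%:E +
      rho 1%N (fun r => recourse rho (T - 2) r x))%E | x in feasible0].

(* A solution assigns a decision to every node (t, history) of the scenario
   tree.  It is encoded as one row vector with one entry for each component of
   each of these decisions. *)
Definition coord := {t : 'I_T & (t.-tuple 'I_K * 'I_(n t))%type}.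

Definition solution := 'rV[R]_#|{: coord}|.

(* The junk value 0 is returned beyond the horizon. *)
Definition decision (x : solution) t (h : t.-tuple 'I_K) : 'cV[R]_(n t) :=
  match @idP (t < T)%N with
  | ReflectT lt_tT =>
      \col_i x 0 (enum_rank
        (Tagged (fun s : 'I_T => (s.-tuple 'I_K * 'I_(n s))%type)
                (i := Ordinal lt_tT) (h, i)))
  | ReflectF _ => 0
  end.

Definition feasible : set solution :=
  [set x | feasible0 (decision x [tuple]) /\
    forall t (h : t.-tuple 'I_K) (r : 'I_K), (t.+1 < T)%N ->
      feasible_next r (decision x h) (decision x (rcons_tuple h r))].

(* Nested cost of x from stage t.+1 on, after the history rcons h r, when
   stage t.+1 is followed by k further stages. *)
Fixpoint cost_to_go (rho : risk) (x : solution) k t (h : t.-tuple 'I_K)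
    (r : 'I_K) : \bar R :=
  ((dot (c P t.+1 r) (decision x (rcons_tuple h r)))%:E +
   (if k is k'.+1
    then rho t.+2 (fun s => cost_to_go rho x k' (rcons_tuple h r) s)
    else 0))%E.

Definition nested_objective (rho : risk) (x : solution) : \bar R :=
  ((dot (c0 P) (decision x [tuple]))%:E +
   rho 1%N (fun r => cost_to_go rho x (T - 2) [tuple] r))%E.

(* A scenario w lists the outcomes of xi_1, ..., xi_(T-1): entry i of w is the
   outcome of xi_(i.+1). *)
Definition history (w : T.-1.-tuple 'I_K) (i : 'I_T.-1) : i.+1.-tuple 'I_K :=
  [tuple tnth w (widen_ord (ltn_ord i) j) | j < i.+1].

Definition scenario_cost (x : solution) (w : T.-1.-tuple 'I_K) : R :=
  dot (c0 P) (decision x [tuple]) +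
  \sum_(i < T.-1) dot (c P i.+1 (tnth w i)) (decision x (history w i)).

(* The outcomes of the different stages are independent. *)
Definition expected_cost (p : nat -> 'rV[R]_K) (x : solution) : R :=
  \sum_(w : T.-1.-tuple 'I_K)
    (\prod_(i < T.-1) p i.+1 0 (tnth w i)) * scenario_cost x w.

Definition neutral_risk (p : nat -> 'rV[R]_K) : risk :=
  fun t => expect (p t).

Definition averse_risk (D : nat -> set 'rV[R]_K) : risk :=
  fun t => sup_expect (D t).

Definition msp_solutions (p : nat -> 'rV[R]_K) : set solution :=
  [set x | feasible x /\
    forall y, feasible y -> expected_cost p x <= expected_cost p y].

Definition rmsp_solutions (D : nat -> set 'rV[R]_K) : set solution :=
  [set x | feasible x /\ forall y, feasible y ->
    (nested_objective (averse_risk D) x <=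
     nested_objective (averse_risk D) y)%E].

Definition dist_to (x : solution) (U : set solution) : \bar R :=
  ereal_inf [set (`|x - y|)%:E | y in U].

End Program.

(* N t is the number of samples of xi_t: the filter "N t --> oo for all the
   random stages t". *)
Definition samples_to_infty (T : nat) : set_system (nat -> nat) :=
  filter_from setT (fun m : nat =>
    [set N | forall t, (0 < t < T)%N -> (m <= N t)%N]).

Global Instance samples_to_infty_filter T : ProperFilter (samples_to_infty T).
Proof.
apply: filter_from_proper; last by move=> m _; exists (fun=> m).
apply: filter_from_filter; first by exists 0%N.
move=> i j _ _; exists (maxn i j) => // N hN.
by split=> t /hN; rewrite geq_max => /andP[].
Qed.

(* Main.v *)
Require Import Defs.
From mathcomp Require Import all_boot all_order all_algebra.
From mathcomp Require Import all_classical all_reals all_analysis.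
From mathcomp Require Import ring lra zify.
Import Order.TTheory GRing.Theory Num.Theory.
Import numFieldNormedType.Exports.

(** Both programs minimize a nested objective over the same set of solutions,
    which is compact; the theorem holds because these objectives converge
    uniformly on it.

    The expectation under [p t] is the supremum of the expectations over the
    singleton [[set p t]], so the risk-neutral program is also a risk-averse
    one and both are treated at once.  A supremum of expectations is monotone
    and commutes with the addition of constants ([sup_expect_le_add]), hence is
    nonexpansive in the costs; as the cost of a decision is linear, the nested
    objective is Lipschitz in the solution ([nested_objective_lip]), with a
    constant that does not depend on the ambiguity sets.  If each distribution
    of one ambiguity set is within [delta] of some distribution of another one,
    then the suprema of the expectation of costs bounded by [M] differ by at
    most [K * delta * M] ([sup_expect_within]), and these errors add up over
    the stages ([nested_objective_within]).  Weak convergence on a finite space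
    is convergence of each probability, so the ambiguity sets shrink to
    [p t] ([near_ambiguities]), and uniform convergence follows.

    Two identities relate these objectives to the quantities of the theorem.
    The optimal value, defined by dynamic programming through the recourse
    functions, is the infimum of the nested objective over the solutions
    ([optimal_value_nested]): decisions that are chosen at each node of the
    scenario tree within [e] of the optimum of the recourse problem lose at
    most [e] per stage.  The nested risk-neutral objective is the expected cost
    under the product distribution ([nested_neutral]).

    Uniform convergence of continuous functions on a compact set then gives
    convergence of the minima ([ereal_inf_cvg]) and of the sets of minimizers
    ([argmin_cvg]). *)

Set Implicit Arguments.
Unset Strict Implicit.
Unset Printing Implicit Defensive.

Local Open Scope classical_set_scope.
Local Open Scope ring_scope.

(** * Stability of minimizers under uniform convergence *)

Lemma continuous_lipschitz (R : realType) (V : normedModType R) (g : V -> R)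
    (L : R) :
  0 <= L -> (forall x y, g x <= g y + L * `|x - y|) -> continuous g.
Proof.
move=> L0 lip x; apply/cvgrPdist_le => e e0; near=> y.
have xy : `|x - y| <= e / (L + 1).
  by near: y; apply: cvgr_dist_le; rewrite ?divr_gt0 ?ltr_wpDl//; exact: cvg_id.
have {}xy : (L + 1) * `|x - y| <= e by rewrite mulrC -ler_pdivlMr ?ltr_wpDl.
have := lip x y; have := lip y x; rewrite (distrC y x) ler_norml.
have := normr_ge0 (x - y); move: xy.
by move=> ? ? ? ?; apply/andP; split; lra.
Unshelve. all: by end_near. Qed.

Section Minimizers.
Context {R : realType} {V : normedModType R}.
Implicit Types (S : set V) (g h : V -> R).

Definition argmin S g : set V :=
  [set x | S x /\ forall y, S y -> g x <= g y].

Lemma compact_argmin S g :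
  S !=set0 -> compact S -> continuous g -> argmin S g !=set0.
Proof.
move=> S0 cS cg.
have [x /set_mem Sx xmin] :=
  compact_EVT_min S0 cS (continuous_subspaceT cg).
by exists x; split=> // y Sy; apply: xmin; exact: mem_set.
Qed.

Lemma ereal_inf_argmin S g x : argmin S g x ->
  ereal_inf [set (g y)%:E | y in S] = (g x)%:E.
Proof.
move=> [Sx xmin]; apply/eqP; rewrite eq_le; apply/andP; split.
  by apply: ereal_inf_lbound; exists x.
by apply: le_ereal_inf_tmp => _ [y Sy <-]; rewrite lee_fin; exact: xmin.
Qed.

(** Every minimizer of a function within [e] of [g] is a [2 * e]-minimizer of
    [g]; on the compact set of points of [S] at distance at least [eta] from
    the minimizers of [g], [g] stays away from its minimum, so that such a
    minimizer is not there once [e] is small. *)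
Lemma near_argmin S g (eta : R) :
  S !=set0 -> compact S -> continuous g -> 0 < eta ->
  exists2 e : R, 0 < e & forall h x,
    (forall y, S y -> `|h y - g y| <= e) -> argmin S h x ->
    exists2 y, argmin S g y & `|x - y| < eta.
Proof.
move=> S0 cS cg eta0.
pose far := S `&` \bigcap_(y in argmin S g) [set x | eta <= `|x - y|].
have cfar : compact far.
  apply: compact_closedI => //; apply: closed_bigI => y _.
  apply: (@closed_comp _ _ (fun x : V => `|x - y|) [set r | eta <= r]).
    move=> x _; apply: cvg_norm.
    by apply: cvgB; [exact: cvg_id|exact: cvg_cst].
  exact: closed_ge.
have near_if_notfar x : S x -> ~ far x ->
    exists2 y, argmin S g y & `|x - y| < eta.
  move=> Sx nfar; apply: contrapT => nearN; apply: nfar; split=> // y gy /=.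
  by rewrite leNgt; apply/negP => xy; apply: nearN; exists y.
have [y0 [Sy0 y0min]] := compact_argmin S0 cS cg.
have [far0|] := pselect (far !=set0); last first.
  move=> far0; exists 1 => // h x _ [Sx _]; apply: near_if_notfar => // fx.
  by apply: far0; exists x.
have [z [farz zmin]] := compact_argmin far0 cfar cg.
have gap : g y0 < g z.
  rewrite lt_neqAle y0min ?andbT; last by case: farz.
  apply/eqP => gyz; case: farz => Sz /(_ z) farzz.
  have gz : argmin S g z by split=> // y Sy; rewrite -gyz; exact: y0min.
  by move: (farzz gz) => /=; rewrite subrr normr0 leNgt eta0.
exists ((g z - g y0) / 3) => [|h x hg [Sx xmin]]; first by lra.
apply: near_if_notfar => // fx.
move: (zmin _ fx) (hg _ Sx) (hg _ Sy0) (xmin _ Sy0).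
rewrite !ler_norml => ? /andP[? ?] /andP[? ?] ?; lra.
Qed.

Section Convergence.
Context {I : Type} {F : set_system I} {FF : ProperFilter F}.
Variables (S : set V) (g : V -> R) (G : I -> V -> R).
Hypotheses (S0 : S !=set0) (cS : compact S) (cg : continuous g).
Hypothesis min_G : forall i, argmin S (G i) !=set0.
Hypothesis unif : forall e, 0 < e ->
  \forall i \near F, forall x, S x -> `|G i x - g x| <= e.

(** The infima are attained, so each of the two minima is at most the value of
    its function at the other minimizer. *)
Lemma ereal_inf_cvg :
  ereal_inf [set (G i x)%:E | x in S] @[i --> F]
    --> ereal_inf [set (g x)%:E | x in S].
Proof.
have [x0 [Sx0 x0min]] := compact_argmin S0 cS cg.
rewrite (ereal_inf_argmin (conj Sx0 x0min)); apply/fine_cvgP; split.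
  by apply: nearW => i; have [x /ereal_inf_argmin ->] := min_G i.
apply/cvgrPdist_le => e e0; near=> i => /=.
have [x [Sx xmin]] := min_G i; rewrite (ereal_inf_argmin (conj Sx xmin)) /=.
have Gg : forall y, S y -> `|G i y - g y| <= e by near: i; exact: unif.
move: (Gg _ Sx) (Gg _ Sx0) (xmin _ Sx0) (x0min _ Sx).
rewrite !ler_norml => /andP[? ?] /andP[? ?] ? ?; apply/andP; split; lra.
Unshelve. all: by end_near. Qed.

(** Nonemptiness of the sets of minimizers matters for the lower bound: the
    supremum of the empty set would be [-oo]. *)
Lemma argmin_cvg :
  ereal_sup [set ereal_inf [set `|x - y|%:E | y in argmin S g]
            | x in argmin S (G i)] @[i --> F] --> 0%E.
Proof.
have dist_ge0 (x : V) :
    (0%E <= ereal_inf [set `|x - y|%:E | y in argmin S g])%E.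
  by apply: le_ereal_inf_tmp => _ [y _ <-]; rewrite lee_fin.
have sup_ge0 i : (0%E <= ereal_sup
    [set ereal_inf [set `|x - y|%:E | y in argmin S g]
    | x in argmin S (G i)])%E.
  have [x Gx] := min_G i.
  by apply: le_ereal_sup_tmp; eexists; [exists x|exact: dist_ge0].
have sup_le e : 0 < e -> \forall i \near F, (ereal_sup
    [set ereal_inf [set `|x - y|%:E | y in argmin S g]
    | x in argmin S (G i)] <= e%:E)%E.
  move=> e0; have [e' e'0 He'] := near_argmin S0 cS cg e0.
  near=> i; apply: ge_ereal_sup => _ [x Gx <-].
  have [|y gy xy] := He' (G i) x _ Gx; first by near: i; exact: unif.
  by apply: ge_ereal_inf; exists (`|x - y|%:E); [exists y|rewrite lee_fin ltW].
apply/fine_cvgP; split.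
  near=> i; rewrite fin_real//; apply/andP; split.
    by rewrite (lt_le_trans _ (sup_ge0 i)) ?ltNy0.
  by rewrite (@le_lt_trans _ _ 1%:E) ?ltry//; near: i; exact: sup_le.
apply/cvgrPdist_le => e e0; near=> i => /=.
have lee : (ereal_sup [set ereal_inf [set `|x - y|%:E | y in argmin S g]
    | x in argmin S (G i)] <= e%:E)%E by near: i; exact: sup_le.
rewrite sub0r normrN ger0_norm; last exact: fine_ge0.
rewrite -lee_fin fineK// fin_real// (lt_le_trans _ (sup_ge0 i)) ?ltNy0//=.
by rewrite (le_lt_trans lee) ?ltry.
Unshelve. all: by end_near. Qed.

End Convergence.
End Minimizers.

Lemma normr_entry_le (R : realType) m n (M : 'M[R]_(m, n)) i j :
  `|M i j| <= `|M|.
Proof.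
rewrite [leRHS]mx_normrE.
exact: (le_bigmax _ (fun ij => `|M ij.1 ij.2|) (i, j)).
Qed.

(** * Suprema of expectations *)

Section SupExpectation.
Context {R : realType} {K : nat}.
Implicit Types (D : set 'rV[R]_K) (Z W : 'I_K -> \bar R) (f : 'rV[R]_K).

Lemma expect_addr f Z (e : R) : is_pmf f ->
  expect f (fun r => Z r + e%:E)%E = (expect f Z + e%:E)%E.
Proof.
move=> [_ f1]; rewrite /expect.
under eq_bigr do rewrite muleDr ?fin_num_adde_defl// -EFinM.
by rewrite big_split /= sumEFin -mulr_suml f1 mul1r.
Qed.

(** This single inequality contains monotonicity ([e = 0]) and, applied in both
    directions, that the supremum is nonexpansive in the costs. *)
Lemma sup_expect_le_add D Z W (e : R) : D `<=` @is_pmf R K ->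
  (forall r, Z r <= W r + e%:E)%E ->
  (sup_expect D Z <= sup_expect D W + e%:E)%E.
Proof.
move=> Dpmf ZW; apply: ge_ereal_sup => _ [f Df <-].
have [f0 _] := Dpmf _ Df.
apply: (@le_trans _ _ (expect f W + e%:E)%E).
  rewrite -expect_addr; last exact: Dpmf.
  by apply: lee_sum => r _; apply: lee_wpmul2l => //; rewrite lee_fin.
by rewrite leeD2r//; apply: ereal_sup_ubound; exists f.
Qed.

Lemma sup_expect0 D : D !=set0 -> sup_expect D (fun=> 0%E) = 0%E.
Proof.
move=> [f0 Df0].
have expect0 f : expect f (fun=> 0%E) = 0%E.
  by rewrite /expect big1// => r _; rewrite mule0.
apply/eqP; rewrite eq_le; apply/andP; split.
  by apply: ge_ereal_sup => _ [f _ <-]; rewrite expect0.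
by apply: ereal_sup_ubound; exists f0.
Qed.

(** One half of the statement that the Hausdorff distance between [D] and [D']
    is at most [delta]. *)
Definition within_of (delta : R) D D' :=
  forall f, D f -> exists2 g, D' g & `|f - g| <= delta.

Lemma sup_expect_within D D' Z (delta M : R) : within_of delta D D' ->
  (forall r, `|Z r| <= M%:E)%E ->
  (sup_expect D Z <= sup_expect D' Z + (K%:R * (delta * M))%:E)%E.
Proof.
move=> DD' ZM; apply: ge_ereal_sup => _ [f Df <-].
have [g D'g fg] := DD' _ Df.
apply: (@le_trans _ _ (expect g Z + (K%:R * (delta * M))%:E)%E); last first.
  by rewrite leeD2r//; apply: ereal_sup_ubound; exists g.
have ZE r : Z r = (fine (Z r))%:E.
  by move: (ZM r); case: (Z r).
have expectE h : expect h Z = (\sum_r h 0 r * fine (Z r))%:E.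
  by rewrite -sumEFin; apply: eq_bigr => r _; rewrite EFinM -ZE.
rewrite !expectE -EFinD lee_fin -lerBlDl -sumrB.
rewrite mulr_natl -[X in _ *+ X]card_ord -sumr_const.
apply: ler_sum => r _; rewrite -mulrBl.
apply: (le_trans (ler_norm _)); rewrite normrM ler_pM//.
  by apply: le_trans fg; have := normr_entry_le (f - g) 0 r; rewrite !mxE.
by have := ZM r; rewrite ZE lee_fin.
Qed.

End SupExpectation.

(** * Regularity of the nested objective *)

Section Nested.
Context {R : realType} {P : program R}.
Notation T := (horizon P).
Notation K := (nout P).
Notation n := (nvar P).
Implicit Types (D : nat -> set 'rV[R]_K) (x y : solution P).

Definition ambiguity_family D := forall t, (0 < t < T)%N ->
  D t !=set0 /\ D t `<=` @is_pmf R K.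

Lemma ler_dot m (u : 'rV[R]_m) (v w : 'cV[R]_m) e :
  (forall i, `|v i 0 - w i 0| <= e) ->
  dot u v <= dot u w + (\sum_j `|u 0 j|) * e.
Proof.
move=> vw; rewrite /dot !mxE -lerBlDl -sumrB mulr_suml.
apply: ler_sum => j _; rewrite -mulrBr; apply: (le_trans (ler_norm _)).
by rewrite normrM ler_wpM2l.
Qed.

Lemma decision_dist x y t (h : t.-tuple 'I_K) i :
  `|decision x h i 0 - decision y h i 0| <= `|x - y|.
Proof.
rewrite /decision; case: {-}_ / idP => [lt_tT|_]; last first.
  by rewrite !mxE subrr normr0.
by rewrite !mxE; have := normr_entry_le (x - y) 0 (enum_rank
  (Tagged (fun s : 'I_T => (s.-tuple 'I_K * 'I_(n s))%type)
          (i := Ordinal lt_tT) (h, i))); rewrite !mxE.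
Qed.

Lemma decision0 t (h : t.-tuple 'I_K) : decision (0 : solution P) h = 0.
Proof.
by rewrite /decision; case: {-}_ / idP => // ?; apply/colP => i; rewrite !mxE.
Qed.

(** A common Lipschitz constant of the costs of all single decisions, with
    respect to the sup norm: it bounds the l1 norms of all cost vectors. *)
Definition cost_slope : R :=
  \sum_j `|c0 P 0 j| + \sum_(t < T) \sum_r \sum_j `|c P t r 0 j|.

Lemma cost_slope_ge0 : 0 <= cost_slope.
Proof.
rewrite addr_ge0//; first exact: sumr_ge0.
by do 2 (apply: sumr_ge0 => ? _); exact: sumr_ge0.
Qed.

Lemma cost_slope_first : \sum_j `|c0 P 0 j| <= cost_slope.
Proof.
by rewrite lerDl; do 2 (apply: sumr_ge0 => ? _); exact: sumr_ge0.
Qed.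

Lemma cost_slope_next t r : (t < T)%N ->
  \sum_j `|c P t r 0 j| <= cost_slope.
Proof.
move=> tT; rewrite /cost_slope (bigD1 (Ordinal tT))//= (bigD1 r)//= addrCA.
rewrite -addrA lerDl !addr_ge0//.
- by apply: sumr_ge0 => ? _; exact: sumr_ge0.
- exact: sumr_ge0.
- by do 2 (apply: sumr_ge0 => ? _); exact: sumr_ge0.
Qed.

Lemma dot_decision_lip x y t (h : t.-tuple 'I_K) (u : 'rV[R]_(n t)) :
  \sum_j `|u 0 j| <= cost_slope ->
  dot u (decision x h) <= dot u (decision y h) + cost_slope * `|x - y|.
Proof.
move=> ule; apply: (le_trans (ler_dot u (decision_dist x y h))).
by rewrite lerD2l ler_wpM2r.
Qed.

Section OneFamily.
Variable D : nat -> set 'rV[R]_K.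
Hypothesis Dfam : ambiguity_family D.

(** Each of the [k.+1] stages that contribute to the cost to go adds at most one
    [cost_slope * `|x - y|], since the supremum of expectations does not expand
    the differences that come from the later stages. *)
Lemma cost_to_go_lip x y k t (h : t.-tuple 'I_K) r : (t.+1 + k < T)%N ->
  (cost_to_go (averse_risk D) x k h r <= cost_to_go (averse_risk D) y k h r
     + (k.+1%:R * (cost_slope * `|x - y|))%:E)%E.
Proof.
elim: k => [|k IHk] in t h r *; rewrite ?addn0 => tkT /=.
  rewrite !adde0 -EFinD lee_fin mul1r.
  exact/dot_decision_lip/cost_slope_next.
have [|_ Dpmf] := @Dfam t.+2; first by lia.
rewrite -[k.+2%:R]natr1 mulrDl mul1r [_ * _ + _]addrC EFinD addeACA leeD//.
  rewrite -EFinD lee_fin; apply/dot_decision_lip/cost_slope_next; lia.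
by apply: sup_expect_le_add => // s; apply: IHk; lia.
Qed.

Lemma nested_objective_lip x y : (2 <= T)%N ->
  (nested_objective (averse_risk D) x <= nested_objective (averse_risk D) y
     + (T%:R * (cost_slope * `|x - y|))%:E)%E.
Proof.
move=> T2; have [|_ Dpmf] := @Dfam 1%N; first by lia.
have -> : T%:R = 1 + (T - 2).+1%:R :> R by rewrite nat1r; congr _%:R; lia.
rewrite /nested_objective mulrDl mul1r EFinD addeACA leeD//.
  rewrite -EFinD lee_fin; exact/dot_decision_lip/cost_slope_first.
by apply: sup_expect_le_add => // s; apply: cost_to_go_lip; lia.
Qed.

Lemma cost_to_go0 k t (h : t.-tuple 'I_K) r : (t.+1 + k < T)%N ->
  cost_to_go (averse_risk D) 0 k h r = 0%E.
Proof.
elim: k => [|k IHk] in t h r *; rewrite ?addn0 => tkT /=;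
  rewrite decision0 /dot mulmx0 mxE add0e//.
rewrite /averse_risk -[RHS](@sup_expect0 _ _ (D t.+2)).
  by congr sup_expect; apply/funext => s; apply: IHk; lia.
by have [|] := @Dfam t.+2; first by lia.
Qed.

Lemma nested_objective0 : (2 <= T)%N ->
  nested_objective (averse_risk D) (0 : solution P) = 0%E.
Proof.
move=> T2; rewrite /nested_objective decision0 /dot mulmx0 mxE add0e.
rewrite /averse_risk -[RHS](@sup_expect0 _ _ (D 1%N)).
  by congr sup_expect; apply/funext => s; apply: cost_to_go0; lia.
by have [|] := @Dfam 1%N; first by lia.
Qed.

(** The objective vanishes at the solution [0], so the Lipschitz estimate
    against [0] bounds all the costs of [x], independently of the ambiguity sets. *)
Definition cost_bound x : R := T%:R * (cost_slope * `|x|).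

Lemma cost_to_go_bound x k t (h : t.-tuple 'I_K) r : (t.+1 + k < T)%N ->
  (`|cost_to_go (averse_risk D) x k h r| <= (cost_bound x)%:E)%E.
Proof.
move=> tkT; apply: (@le_trans _ _ (k.+1%:R * (cost_slope * `|x|))%:E).
  have := cost_to_go_lip x 0 h r tkT; have := cost_to_go_lip 0 x h r tkT.
  rewrite cost_to_go0// sub0r subr0 normrN add0e.
  case: (cost_to_go _ _ _ _ _) => [a| |] //=.
  by rewrite -EFinD !lee_fin ler_norml => ? ?; apply/andP; split; lra.
rewrite lee_fin ler_wpM2r ?mulr_ge0 ?cost_slope_ge0// ler_nat; lia.
Qed.

Lemma nested_objective_fin x : (2 <= T)%N ->
  nested_objective (averse_risk D) x \is a fin_num.
Proof.
move=> T2.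
have := nested_objective_lip x 0 T2; have := nested_objective_lip 0 x T2.
by rewrite nested_objective0// add0e; case: (nested_objective _ _).
Qed.

Lemma nested_objective_continuous : (2 <= T)%N ->
  continuous (fun x => fine (nested_objective (averse_risk D) x)).
Proof.
move=> T2; apply: (@continuous_lipschitz _ _ _ (T%:R * cost_slope)).
  by rewrite mulr_ge0// cost_slope_ge0.
move=> x y; rewrite -lee_fin EFinD !fineK ?nested_objective_fin// -mulrA.
exact: nested_objective_lip.
Qed.

End OneFamily.

Section TwoFamilies.
Variables (D D' : nat -> set 'rV[R]_K) (delta : R).
Hypotheses (Dfam : ambiguity_family D) (D'fam : ambiguity_family D').
Hypothesis DD' : forall t, (0 < t < T)%N -> within_of delta (D t) (D' t).

(** The error made at a stage comes from the change of ambiguity set there;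
    errors of later stages pass through the supremum unamplified. *)
Lemma cost_to_go_within x k t (h : t.-tuple 'I_K) r : (t.+1 + k < T)%N ->
  (cost_to_go (averse_risk D) x k h r <= cost_to_go (averse_risk D') x k h r
     + (k%:R * (K%:R * (delta * cost_bound x)))%:E)%E.
Proof.
elim: k => [|k IHk] in t h r *; rewrite ?addn0 => tkT /=.
  by rewrite mul0r !adde0.
have [|_ Dpmf] := @Dfam t.+2; first by lia.
rewrite -addeA leeD2l// -[k.+1%:R]natr1 mulrDl mul1r.
rewrite [_ * _ + _]addrC EFinD addeA.
apply: (@le_trans _ _ (sup_expect (D t.+2)
    (fun s => cost_to_go (averse_risk D') x k (rcons_tuple h r) s)
    + (k%:R * (K%:R * (delta * cost_bound x)))%:E)%E).
  by apply: sup_expect_le_add => // s; apply: IHk; lia.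
rewrite leeD2r//; apply: sup_expect_within; first by apply: DD'; lia.
by move=> s; apply: cost_to_go_bound => //; lia.
Qed.

Lemma nested_objective_within x : (2 <= T)%N ->
  (nested_objective (averse_risk D) x <= nested_objective (averse_risk D') x
     + ((T.-1)%:R * (K%:R * (delta * cost_bound x)))%:E)%E.
Proof.
move=> T2.
have [|_ Dpmf] := @Dfam 1%N; first by lia.
have -> : T.-1%:R = (T - 2)%:R + 1 :> R by rewrite natr1; congr _%:R; lia.
rewrite /nested_objective -addeA leeD2l// mulrDl mul1r.
rewrite [_ * _ + _]addrC EFinD addeA.
apply: (@le_trans _ _ (sup_expect (D 1%N)
    (fun s => cost_to_go (averse_risk D') x (T - 2) [tuple] s)
    + ((T - 2)%:R * (K%:R * (delta * cost_bound x)))%:E)%E).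
  by apply: sup_expect_le_add => // s; apply: cost_to_go_within; lia.
rewrite leeD2r//; apply: sup_expect_within; first by apply: DD'; lia.
by move=> s; apply: cost_to_go_bound => //; lia.
Qed.

End TwoFamilies.
End Nested.

(** * Histories *)

Section Histories.
Variable (K : finType).

Definition front t (h : t.+1.-tuple K) : t.-tuple K :=
  [tuple tnth h (widen_ord (leqnSn t) i) | i < t].

Definition back t (h : t.+1.-tuple K) : K := tnth h ord_max.

Lemma tnth_rcons_widen t (h : t.-tuple K) r (i : 'I_t) (j : 'I_t.+1) :
  i = j :> nat -> tnth (rcons_tuple h r) j = tnth h i.
Proof.
move=> ij; rewrite !(tnth_nth r) /= nth_rcons size_tuple -ij.
by rewrite ltn_ord.
Qed.

Lemma tnth_rcons_lift t (h : t.-tuple K) r i :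
  tnth (rcons_tuple h r) (widen_ord (leqnSn t) i) = tnth h i.
Proof. exact: tnth_rcons_widen. Qed.

Lemma back_rcons t (h : t.-tuple K) r : back (rcons_tuple h r) = r.
Proof. by rewrite /back (tnth_nth r) /= nth_rcons size_tuple ltnn eqxx. Qed.

Lemma front_rcons t (h : t.-tuple K) r : front (rcons_tuple h r) = h.
Proof.
by apply: eq_from_tnth => i; rewrite tnth_mktuple (@tnth_rcons_widen _ _ _ i).
Qed.

Lemma rcons_front_back t (h : t.+1.-tuple K) :
  rcons_tuple (front h) (back h) = h.
Proof.
apply: eq_from_tnth => i; have [it|it] := ltnP i t.
  rewrite (@tnth_rcons_widen _ _ _ (Ordinal it))// tnth_mktuple.
  by congr tnth; exact: val_inj.
suff -> : i = ord_max by exact: back_rcons.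
by apply/val_inj/eqP; rewrite eqn_leq it -ltnS ltn_ord.
Qed.

Lemma sum_rcons_tuple (R : nmodType) t (F : t.+1.-tuple K -> R) :
  \sum_h F h = \sum_h \sum_r F (rcons_tuple h r).
Proof.
rewrite pair_big /= (reindex (fun u : _ * _ => rcons_tuple u.1 u.2))//=.
exists (fun h => (front h, back h)) => [[h r] _|h _] /=.
  by rewrite front_rcons back_rcons.
exact: rcons_front_back.
Qed.

End Histories.

(** * Interchange of infima and risk measures *)

Section Interchange.
Context {R : realType} {P : program R}.
Notation T := (horizon P).
Notation K := (nout P).
Notation n := (nvar P).
Implicit Types x : solution P.

Lemma decision_reachable x t (h : t.-tuple 'I_K) : feasible x -> (t < T)%N ->
  reachable (decision x h).
Proof.
move=> [x0 xnext]; elim: t => [|t IHt] in h *; first by rewrite (tuple0 h).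
move=> tT; rewrite -(rcons_front_back h).
exists (decision x (front h)), (back h).
by split; [apply: IHt; lia|exact: xnext].
Qed.

(** Solutions are single row vectors: this lemma lets one define them node by
    node instead. *)
Lemma decision_prescribed (dec : forall t, t.-tuple 'I_K -> 'cV[R]_(n t)) :
  exists x, forall t (h : t.-tuple 'I_K), (t < T)%N -> decision x h = dec t h.
Proof.
pose entry (u : Defs.coord P) := dec (tag u) (tagged u).1 (tagged u).2 0.
exists (\row_k entry (enum_val k)).
move=> t h tT; rewrite /decision; case: {-}_ / idP => // tT'.
by apply/colP => i; rewrite !mxE enum_rankK.
Qed.

Variable D : nat -> set 'rV[R]_K.
Hypothesis Dfam : ambiguity_family D.
Notation rho := (averse_risk D).

(** The decisions of [x] are candidates in the successive infima that define the
    recourse function. *)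
Lemma recourse_le_cost_to_go x k t (h : t.-tuple 'I_K) r : feasible x ->
  (t.+1 + k < T)%N ->
  (recourse rho k r (decision x h) <= cost_to_go rho x k h r)%E.
Proof.
move=> xfeas; have [_ xnext] := xfeas.
elim: k => [|k IHk] in t h r * => tkT /=; apply: ge_ereal_inf;
  eexists; try by exists (decision x (rcons_tuple h r)) => //; apply: xnext; lia.
  by [].
have [|_ Dpmf] := @Dfam t.+2; first by lia.
rewrite leeD2l// -[leRHS]adde0; apply: sup_expect_le_add => // s.
by rewrite adde0; apply: IHk; lia.
Qed.

Lemma optimal_value_le_nested x : (2 <= T)%N -> feasible x ->
  (optimal_value rho <= nested_objective rho x)%E.
Proof.
move=> T2 xfeas; have [x0 _] := xfeas; apply: ge_ereal_inf.
eexists; first by exists (decision x [tuple]).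
have [|_ Dpmf] := @Dfam 1%N; first by lia.
rewrite leeD2l// -[leRHS]adde0; apply: sup_expect_le_add => // s.
by rewrite adde0; apply: recourse_le_cost_to_go => //; lia.
Qed.

Hypothesis bounded : recourse_bounded rho.

(** A greedy policy: the decision after the history [rcons h r] is a minimizer
    up to [e] of the recourse problem posed by the decision after [h].  Such
    decisions exist because the recourse is finite; the errors [e] of
    the stages add up. *)
Lemma near_optimal_solution (x0 : 'cV[R]_(n 0)) (e : R) :
  (2 <= T)%N -> feasible0 x0 -> 0 < e ->
  exists2 x, feasible x & (nested_objective rho x <=
    (dot (c0 P) x0)%:E + rho 1%N (fun r => recourse rho (T - 2) r x0)
    + (T%:R * e)%:E)%E.
Proof.
move=> T2 fx0 e0.
pose tail k t (x : 'cV[R]_(n t.+1)) : \bar R :=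
  if k is k'.+1 then rho t.+2 (fun s => recourse rho k' s x) else 0%E.
pose greedy t r (y : 'cV[R]_(n t)) : set 'cV[R]_(n t.+1) :=
  [set x | feasible_next r y x /\ ((dot (c P t.+1 r) x)%:E +
    tail (T - t.+2)%N t x <= recourse rho (T - t.+2) r y + e%:E)%E].
have greedy_ex t r (y : 'cV[R]_(n t)) : (t.+1 < T)%N ->
    reachable y -> greedy t r y !=set0.
  move=> tT /(bounded tT) /(_ r) fin.
  have recourseE k : recourse rho k r y = ereal_inf [set
      ((dot (c P t.+1 r) x)%:E + tail k t x)%E | x in feasible_next r y].
    by case: k.
  have := fin; rewrite recourseE => fin'.
  have [_ [x yx <-] lt_x] := lb_ereal_inf_adherent e0 fin'.
  by exists x; split=> //; rewrite recourseE; exact: ltW.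
(* Nodes where no greedy decision exists receive the default decision 0. *)
pose dec := fix dec t : t.-tuple 'I_K -> 'cV[R]_(n t) :=
  match t with
  | 0 => fun=> x0
  | s.+1 => fun h => xget 0 (greedy s (back h) (dec s (front h)))
  end.
have decS t (h : t.-tuple 'I_K) r :
    dec t.+1 (rcons_tuple h r) = xget 0 (greedy t r (dec t h)).
  by rewrite /= front_rcons back_rcons.
have dec_greedy t (h : t.-tuple 'I_K) r : (t.+1 < T)%N ->
    reachable (dec t h) -> greedy t r (dec t h) (dec t.+1 (rcons_tuple h r)).
  move=> tT hreach; have [x gx] := greedy_ex t r (dec t h) tT hreach.
  by rewrite decS; apply: xgetPex; exists x.
have dec_reach t (h : t.-tuple 'I_K) : (t < T)%N -> reachable (dec t h).
  elim: t => [//|t IHt] in h * => tT.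
  have reach : reachable (dec t (front h)) by apply: IHt; lia.
  rewrite -(rcons_front_back h); exists (dec t (front h)), (back h).
  by split=> //; have [] := dec_greedy t (front h) (back h) tT reach.
have [x xdec] := decision_prescribed dec; exists x.
  split=> [|t h r tT]; first by rewrite xdec//; lia.
  have reach : reachable (dec t h) by apply: dec_reach; lia.
  by rewrite !xdec//; [have [] := dec_greedy t h r tT reach|lia].
have cost_le k t (h : t.-tuple 'I_K) r : (t.+2 + k)%N = T ->
    (cost_to_go rho x k h r <=
     recourse rho k r (dec t h) + (k.+1%:R * e)%:E)%E.
  elim: k => [|k IHk] in t h r * => tkT.
    have reach : reachable (dec t h) by apply: dec_reach; lia.
    have [|_] := dec_greedy t h r _ reach; first by lia.
    have -> : (T - t.+2 = 0)%N by lia.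
    by rewrite /= xdec ?mul1r//; lia.
  have reach : reachable (dec t h) by apply: dec_reach; lia.
  have [|_] := dec_greedy t h r _ reach; first by lia.
  have -> : (T - t.+2 = k.+1)%N by lia.
  set V := recourse rho k.+1 r (dec t h) => greedy_le.
  rewrite -[k.+2%:R]natr1 mulrDl mul1r [_ * _ + _]addrC EFinD addeA /=.
  apply: le_trans (leeD2r _ greedy_le); rewrite xdec; last by lia.
  rewrite /tail -addeA leeD2l//.
  have [|_ Dpmf] := @Dfam t.+2; first by lia.
  by apply: sup_expect_le_add => // s; apply: IHk; lia.
rewrite /nested_objective xdec; last by lia.
rewrite -addeA leeD2l//.
have [|_ Dpmf] := @Dfam 1%N; first by lia.
apply: sup_expect_le_add => // s.
apply: le_trans (cost_le _ _ _ _ _) _; first lia.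
rewrite leeD2l// lee_fin ler_wpM2r ?(ltW e0)// ler_nat; lia.
Qed.

Lemma feasible_nonempty : (2 <= T)%N -> @feasible0 R P !=set0 ->
  @feasible R P !=set0.
Proof.
move=> T2 [x0 fx0]; have [x ? _] := near_optimal_solution T2 fx0 ltr01.
by exists x.
Qed.

Lemma optimal_value_nested : (2 <= T)%N ->
  optimal_value rho =
  ereal_inf [set nested_objective rho x | x in @feasible R P].
Proof.
move=> T2; apply/eqP; rewrite eq_le; apply/andP; split.
  by apply: le_ereal_inf_tmp => _ [x xfeas <-]; exact: optimal_value_le_nested.
apply: le_ereal_inf_tmp => _ [x0 fx0 <-]; apply/lee_addgt0Pr => e e0.
have T0 : 0 < T%:R :> R by rewrite ltr0n; lia.
have eT : 0 < e / T%:R by rewrite divr_gt0.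
have [x xfeas xle] := near_optimal_solution T2 fx0 eT.
apply: ge_ereal_inf; exists (nested_objective rho x); first by exists x.
by apply: (le_trans xle); rewrite mulrC divfK// gt_eqF.
Qed.

End Interchange.

(** * The risk-neutral objective as an expected cost *)

Section ExpectedCost.
Context {R : realType} {P : program R}.
Notation T := (horizon P).
Notation K := (nout P).
Notation n := (nvar P).
Variables (p : nat -> 'rV[R]_K) (x : solution P).

Lemma neutral_riskE :
  neutral_risk p = averse_risk (fun t => [set p t]) :> risk P.
Proof.
apply/funext => t; apply/funext => Z.
by rewrite /averse_risk /sup_expect image_set1 ereal_sup1.
Qed.

(** [prefix], [path_prob] and [path_cost] extend the ingredients of
    [expected_cost] from complete scenarios to histories of any length [m]. *)
Definition prefix m (w : m.-tuple 'I_K) (i : 'I_m) : i.+1.-tuple 'I_K :=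
  [tuple tnth w (widen_ord (ltn_ord i) j) | j < i.+1].

Definition path_prob m (w : m.-tuple 'I_K) : R :=
  \prod_(i < m) p i.+1 0 (tnth w i).

Definition path_cost m (w : m.-tuple 'I_K) : R :=
  dot (c0 P) (decision x [tuple]) +
  \sum_(i < m) dot (c P i.+1 (tnth w i)) (decision x (prefix w i)).

Fixpoint future_cost k t (h : t.-tuple 'I_K) : R :=
  if k is k'.+1 then
    \sum_r p t.+1 0 r * (dot (c P t.+1 r) (decision x (rcons_tuple h r)) +
                         future_cost k' (rcons_tuple h r))
  else 0.

Lemma path_prob_rcons m (w : m.-tuple 'I_K) r :
  path_prob (rcons_tuple w r) = path_prob w * p m.+1 0 r.
Proof.
rewrite /path_prob big_ord_recr /= -[tnth _ ord_max]/(back _) back_rcons.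
by under eq_bigr do rewrite tnth_rcons_lift.
Qed.

Lemma path_cost_rcons m (w : m.-tuple 'I_K) r :
  path_cost (rcons_tuple w r) = path_cost w +
    dot (c P m.+1 r) (decision x (rcons_tuple w r)).
Proof.
rewrite /path_cost big_ord_recr /= -[tnth _ ord_max]/(back _) back_rcons addrA.
congr (_ + _); last first.
  congr (dot _ (decision x _)).
  by apply: eq_from_tnth => j; rewrite tnth_mktuple; congr tnth; exact: val_inj.
congr (_ + _); apply: eq_bigr => i _.
rewrite tnth_rcons_lift; congr (dot _ (decision x _)).
by apply: eq_from_tnth => j; rewrite !tnth_mktuple; exact: tnth_rcons_widen.
Qed.

(** The tower property: an average over the histories of length [j], of the cost
    so far plus the expected future cost, does not change with [j].  For
    [j = 0] it is the nested objective, and for [j = m] the expected cost. *)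
Lemma sum_path_cost m k j : (j + k)%N = m ->
  (forall t, (0 < t <= m)%N -> is_pmf (p t)) ->
  \sum_(w : j.-tuple 'I_K) path_prob w * (path_cost w + future_cost k w) =
  \sum_(w : m.-tuple 'I_K) path_prob w * path_cost w.
Proof.
move=> + ppmf; elim: k => [|k IHk] in j *.
  by rewrite addn0 => <-; apply: eq_bigr => w _; rewrite addr0.
move=> jkm; rewrite -(IHk j.+1); last by lia.
rewrite sum_rcons_tuple; apply: eq_bigr => w _.
have [_ p1] : is_pmf (p j.+1) by apply: ppmf; lia.
under [RHS]eq_bigr do
  rewrite path_prob_rcons path_cost_rcons -addrA -mulrA mulrDr.
rewrite -mulr_sumr; congr (_ * _).
by rewrite big_split /= -mulr_suml p1 mul1r.
Qed.

Lemma cost_to_go_future k t (h : t.-tuple 'I_K) r :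
  cost_to_go (neutral_risk p) x k h r =
  (dot (c P t.+1 r) (decision x (rcons_tuple h r)) +
   future_cost k (rcons_tuple h r))%:E.
Proof.
elim: k => [|k IHk] in t h r *; first by rewrite /= adde0 addr0.
rewrite EFinD /=; congr (_ + _)%E; rewrite -sumEFin.
by apply: eq_bigr => s _; rewrite IHk -EFinM.
Qed.

Lemma nested_neutral : (2 <= T)%N ->
  (forall t, (0 < t < T)%N -> is_pmf (p t)) ->
  nested_objective (neutral_risk p) x = (expected_cost p x)%:E.
Proof.
move=> T2 ppmf.
transitivity (dot (c0 P) (decision x [tuple]) + future_cost T.-1 [tuple])%:E.
  have -> : T.-1 = (T - 2).+1 by lia.
  rewrite EFinD /nested_objective; congr (_ + _)%E; rewrite /= -sumEFin.
  by apply: eq_bigr => r _; rewrite cost_to_go_future -EFinM.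
congr EFin; rewrite -[RHS](@sum_path_cost T.-1 T.-1 0)//; last first.
  by move=> t tT; apply: ppmf; lia.
rewrite (eq_bigl (pred1 [tuple])) => [|w]; last exact/esym/eqP/tuple0.
by rewrite big_pred1_eq /path_prob /path_cost !big_ord0 mul1r addr0.
Qed.

End ExpectedCost.

(** * Convergence of the ambiguity sets *)

Lemma near_samples T (Q : nat -> nat -> Prop) :
  (forall t, (0 < t < T)%N -> \forall m \near \oo, Q t m) ->
  \forall N \near samples_to_infty T, forall t, (0 < t < T)%N -> Q t (N t).
Proof.
move=> Qnear.
have : \forall N \near samples_to_infty T,
    forall i : 'I_T, (0 < i)%N -> Q i (N (i : nat)).
  apply: filter_forall => i; have [i0|i0] := ltnP 0 i; last exact: nearW.
  have /Qnear[m _ mQ] : (0 < i < T)%N by rewrite i0 ltn_ord.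
  by exists m => // N mN _; apply: mQ => /=; apply: mN; rewrite i0 ltn_ord.
apply: filterS => N QN t /andP[t0 tT]; exact: (QN (Ordinal tT) t0).
Qed.

(** Testing weak convergence against the indicators of single outcomes gives the
    convergence of each entry. *)
Lemma weakly_cvg_norm (R : realType) K (f : nat -> 'rV[R]_K) (p : 'rV[R]_K)
    (e : R) :
  weakly_cvg f p -> 0 < e -> \forall m \near \oo, `|f m - p| <= e.
Proof.
move=> fp e0.
have entries : \forall m \near \oo, forall r, `|p 0 r - f m 0 r| <= e.
  apply: filter_forall => r.
  have pick (q : 'rV[R]_K) : \sum_s q 0 s * (s == r)%:R = q 0 r.
    rewrite (bigD1 r)//= eqxx mulr1 big1 ?addr0// => s /negPf ->.
    by rewrite mulr0.
  have := fp (fun s => (s == r)%:R); rewrite pick => /cvgr_dist_le /(_ _ e0).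
  by apply: filterS => m; rewrite pick.
apply: filterS entries => m entries.
rewrite [leLHS]mx_normrE; apply: bigmax_le; first exact: ltW.
by case=> i j _ /=; rewrite ord1 !mxE distrC.
Qed.

Section AmbiguityConvergence.
Context {R : realType} {P : program R}.
Notation T := (horizon P).
Notation K := (nout P).
Variables (p : nat -> 'rV[R]_K) (f0 : nat -> nat -> 'rV[R]_K).
Variable d : nat -> nat -> R.
Hypothesis f0_pmf : forall t m, (0 < t < T)%N -> is_pmf (f0 t m).
Hypothesis f0_cvg : forall t, (0 < t < T)%N -> weakly_cvg (f0 t) (p t).
Hypothesis d_ge0 : forall t m, (0 < t < T)%N -> 0 <= d t m.
Hypothesis d_cvg : forall t, (0 < t < T)%N -> d t m @[m --> \oo] --> 0.

Lemma ambiguities_center N t : (0 < t < T)%N ->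
  ambiguities f0 d N t (f0 t (N t)).
Proof. by move=> tT; split; [exact: f0_pmf|rewrite subrr normr0 d_ge0]. Qed.

Lemma ambiguities_family N : @ambiguity_family R P (ambiguities f0 d N).
Proof.
move=> t tT; split; first by exists (f0 t (N t)); exact: ambiguities_center.
by move=> f [].
Qed.

Lemma near_tolerance (e : R) : 0 < e -> \forall N \near samples_to_infty T,
  forall t, (0 < t < T)%N -> d t (N t) <= e.
Proof.
move=> e0; apply: (near_samples (Q := fun t m => d t m <= e)) => t tT.
have /cvgr_dist_le /(_ _ e0) := d_cvg tT; apply: filterS => m.
by rewrite sub0r normrN; apply: le_trans; exact: ler_norm.
Qed.

Lemma near_ambiguities (e : R) : 0 < e -> \forall N \near samples_to_infty T,
  forall t, (0 < t < T)%N ->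
  forall f, ambiguities f0 d N t f -> `|f - p t| <= e.
Proof.
move=> e0; have e20 : 0 < e / 2 by rewrite divr_gt0.
have near_f0 := near_samples (fun t tT => weakly_cvg_norm (f0_cvg tT) e20).
apply: filterS2 near_f0 (near_tolerance e20) => N f0p dN t tT f [_ ff0].
rewrite (splitr e) -(subrKA (f0 t (N t))) (le_trans (ler_normD _ _))// lerD//.
  by apply: le_trans ff0 _; exact: dN.
exact: f0p.
Qed.

Lemma max_deviation_cvg t (f : (nat -> nat) -> 'rV[R]_K) : (0 < t < T)%N ->
  (forall N, ambiguities f0 d N t (f N)) ->
  \big[Num.max/0]_r `|f N 0 r - f0 t (N t) 0 r|
    @[N --> samples_to_infty T] --> 0.
Proof.
move=> tT Df; apply/cvgrPdist_le => e e0.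
apply: filterS (near_tolerance e0) => N dN.
rewrite sub0r normrN ger0_norm; last exact: bigmax_ge_id.
apply: bigmax_le => [|r _]; first exact: ltW.
have [_ ff0] := Df N; apply: le_trans (dN t tT); apply: le_trans ff0.
by have := normr_entry_le (f N - f0 t (N t)) 0 r; rewrite !mxE.
Qed.

Lemma singleton_family : (forall t, (0 < t < T)%N -> is_pmf (p t)) ->
  @ambiguity_family R P (fun t => [set p t]).
Proof. by move=> ppmf t tT; split=> [|f ->]; [exists (p t)|exact: ppmf]. Qed.

Lemma nested_objective_unif_cvg (e : R) : (2 <= T)%N ->
  (forall t, (0 < t < T)%N -> is_pmf (p t)) ->
  compact (@feasible R P) -> 0 < e ->
  \forall N \near samples_to_infty T, forall x : solution P, feasible x ->
    `|fine (nested_objective (averse_risk (ambiguities f0 d N)) x)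
      - expected_cost p x| <= e.
Proof.
move=> T2 ppmf cfeas e0.
have [M xM] : exists M, forall x : solution P, feasible x -> `|x| <= M.
  have [M [_ xM]] := compact_bounded cfeas.
  by exists (M + 1) => x; apply: xM; rewrite ltrDl.
(* C * delta bounds the difference of the objectives on solutions of norm M. *)
pose C := T.-1%:R * (K%:R * (T%:R * (@cost_slope _ P * `|M|))).
have C0 : 0 <= C by rewrite !mulr_ge0// cost_slope_ge0.
have C1 : 0 < C + 1 by lra.
have eC : 0 < e / (C + 1) by rewrite divr_gt0.
have famp := singleton_family ppmf.
apply: filterS (near_ambiguities eC) => N closeN x xfeas.
have famN := ambiguities_family N.
have [near1 near2] :
  (forall t, (0 < t < T)%N ->
     within_of (e / (C + 1)) (ambiguities f0 d N t) [set p t]) /\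
  (forall t, (0 < t < T)%N ->
     within_of (e / (C + 1)) [set p t] (ambiguities f0 d N t)).
  split=> t tT f; first by move=> Df; exists (p t) => //; exact: closeN.
  move=> ->; exists (f0 t (N t)); first exact: ambiguities_center.
  by rewrite distrC; apply: closeN => //; exact: ambiguities_center.
have err : T.-1%:R * (K%:R * (e / (C + 1) * cost_bound x)) <= e.
  apply: (@le_trans _ _ (C * (e / (C + 1)))).
    rewrite [leRHS](_ : _ = T.-1%:R * (K%:R * (e / (C + 1) *
      (T%:R * (@cost_slope _ P * `|M|))))); last by rewrite /C; ring.
    rewrite /cost_bound !ler_wpM2l// ?cost_slope_ge0// ?(ltW eC)//.
    by apply: le_trans (ler_norm M); exact: xM.
  by rewrite mulrA ler_pdivrMr//; lra.
have := nested_objective_within famN famp near1 x T2.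
have := nested_objective_within famp famN near2 x T2.
rewrite -neutral_riskE nested_neutral//.
have /fineK <- := nested_objective_fin famN x T2.
rewrite -!EFinD !lee_fin => ? ?; rewrite ler_norml; apply/andP; split; lra.
Qed.

End AmbiguityConvergence.

(** * Convergence of optimal values and solutions *)

Theorem theorem1 (R : realType) (P : program R)
    (p : nat -> 'rV[R]_(nout P))
    (f0 : nat -> nat -> 'rV[R]_(nout P))
    (d : nat -> nat -> R) :
  (2 <= horizon P)%N ->
  (forall t, (0 < t < horizon P)%N -> is_pmf (p t)) ->
  (forall t N, (0 < t < horizon P)%N -> is_pmf (f0 t N)) ->
  (forall t, (0 < t < horizon P)%N -> weakly_cvg (f0 t) (p t)) ->
  (forall t N, (0 < t < horizon P)%N -> 0 <= d t N) ->
  (forall t N N', (0 < t < horizon P)%N -> (N <= N')%N -> d t N' <= d t N) ->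
  (forall t, (0 < t < horizon P)%N -> d t N @[N --> \oo] --> 0) ->
  @feasible0 R P !=set0 ->
  compact (@feasible R P) ->
  relatively_complete_recourse P ->
  recourse_bounded (neutral_risk p) ->
  (forall N : nat -> nat, recourse_bounded (averse_risk (ambiguities f0 d N))) ->
  [/\ forall t, (0 < t < horizon P)%N ->
        forall f : (nat -> nat) -> 'rV[R]_(nout P),
        (forall N, ambiguities f0 d N t (f N)) ->
        \big[Num.max/0]_r `|f N 0 r - f0 t (N t) 0 r|
          @[N --> samples_to_infty (horizon P)] --> 0,
      optimal_value (averse_risk (ambiguities f0 d N))
        @[N --> samples_to_infty (horizon P)]
        --> optimal_value (neutral_risk p)
    & ereal_sup [set dist_to x (msp_solutions p)
                | x in rmsp_solutions (ambiguities f0 d N)]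
        @[N --> samples_to_infty (horizon P)] --> 0%E].
Proof.
move=> T2 ppmf f0pmf f0cvg d0 _ dcvg feas0 cfeas _ pbounded Nbounded.
pose G N (x : solution P) :=
  fine (nested_objective (averse_risk (ambiguities f0 d N)) x).
have famp := singleton_family ppmf.
have famN N : @ambiguity_family R P (ambiguities f0 d N).
  exact: ambiguities_family.
have GE N x : nested_objective (averse_risk (ambiguities f0 d N)) x =
    (G N x)%:E by rewrite fineK//; exact: nested_objective_fin.
have pE x : nested_objective (neutral_risk p) x = (expected_cost p x)%:E.
  exact: nested_neutral.
have gcont : continuous (expected_cost p : solution P -> R).
  rewrite (_ : expected_cost p =
    fun x => fine (nested_objective (averse_risk (fun t => [set p t])) x)).
    exact: nested_objective_continuous.
  by apply/funext => x; rewrite -neutral_riskE pE.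
have Gcont N : continuous (G N) by exact: nested_objective_continuous.
have feas : @feasible R P !=set0.
  exact: (feasible_nonempty (famN (fun=> 0%N))).
have Gmin N : argmin (@feasible R P) (G N) !=set0 by exact: compact_argmin.
have unif e : 0 < e -> \forall N \near samples_to_infty (horizon P),
    forall x : solution P, feasible x -> `|G N x - expected_cost p x| <= e.
  exact: nested_objective_unif_cvg.
split.
- by move=> t tT f; exact: (max_deviation_cvg dcvg).
- have -> : optimal_value (neutral_risk p) =
      ereal_inf [set (expected_cost p x)%:E | x in @feasible R P].
    move: pbounded; rewrite neutral_riskE => pbounded.
    rewrite optimal_value_nested// -neutral_riskE.
    by congr ereal_inf; apply: eq_imagel => x _; exact: pE.
  have -> : (fun N => optimal_value (averse_risk (ambiguities f0 d N))) =
      fun N => ereal_inf [set (G N x)%:E | x in @feasible R P].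
    apply/funext => N; rewrite optimal_value_nested//.
    by congr ereal_inf; apply: eq_imagel => x _; exact: GE.
  exact: ereal_inf_cvg.
- have rmspE N : rmsp_solutions (ambiguities f0 d N) =
      argmin (@feasible R P) (G N).
    by apply/seteqP; split=> x [xfeas xmin]; split=> // y /xmin;
      rewrite !GE lee_fin.
  have -> : (fun N => ereal_sup [set dist_to x (msp_solutions p)
      | x in rmsp_solutions (ambiguities f0 d N)]) =
    fun N => ereal_sup [set ereal_inf [set `|x - y|%:E
      | y in argmin (@feasible R P) (expected_cost p)]
      | x in argmin (@feasible R P) (G N)].
    by apply/funext => N; rewrite rmspE.
  exact: argmin_cvg.
Qed.
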